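(* Let $\varepsilon>0$ and let $k$ and $n$ be positive integers. If $n>\left(\frac{2}{\varepsilon}\right)^{S(k)^2}$, then \[ n-n^{1/S'(k)}\le g_*(k,n) \le n-(1-\varepsilon)\, n^{1/S(k)}. \]
   Context: For a positive integer $m$, $[m]=\{1,\dots,m\}$ and $[2,m]=\{2,\dots,m\}$. Integers $a,b,c$ (not necessarily distinct) form a product Schur triple if $ab=c$. The Schur number $S(k)$ is the minimum $m\in\mathbb{N}$ such that every $k$-colouring of $[m]$ contains a monochromatic solution of $a+b=c$ (with $a,b,c\in[m]$ not necessarily distinct). The double-sum Schur number $S'(k)$ is the minimum $m\in\mathbb{N}$ such that every $k$-colouring of $[m]$ contains a monochromatic solution of $a+b=c$ or of $a+b=c-1$. $g_*(k,n)$ denotes the largest size of a set $A\subseteq[2,n]$ that admits a $k$-colouring with no monochromatic product Schur triple (i.e. $A$ can be partitioned into $k$ sets none of which contains $a,b,c$ with $ab=c$). *)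

(* Defs.v *)
From mathcomp Require Import all_boot.
From mathcomp Require Import zify.

Set Implicit Arguments.
Unset Strict Implicit.
Unset Printing Implicit Defensive.

Local Open Scope nat_scope.

(** Subsets of [{0, .., m}] have type [{set 'I_m.+1}], so that an index is the
    integer it denotes. *)
Definition nat_interval (l m : nat) : {set 'I_m.+1} := [set i : 'I_m.+1 | l <= i].

(** A [k]-colouring of a set [A] is represented by a function defined on all of
    [{0, .., m}], of which only the values on [A] matter. *)
Definition has_mono (P : nat -> nat -> nat -> bool) (k m : nat)
    (A : {set 'I_m.+1}) (chi : {ffun 'I_m.+1 -> 'I_k}) : bool :=
  [exists a in A, exists b in A, exists c in A,
     [&& P a b c, chi a == chi b & chi b == chi c]].

Definition schur_triple (a b c : nat) : bool := a + b == c.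

(** [c.-1] is the integer [c - 1] whenever [c] is positive. *)
Definition double_sum_triple (a b c : nat) : bool :=
  (a + b == c) || (a + b == c.-1).

Definition product_schur_triple (a b c : nat) : bool := a * b == c.

Definition unavoidable (P : nat -> nat -> nat -> bool) (k m : nat) : bool :=
  [forall chi : {ffun 'I_m.+1 -> 'I_k}, has_mono P (nat_interval 1 m) chi].

(** Schur's theorem, needed for the minima below to exist. *)
Fixpoint schur_bound (j : nat) : nat :=
  if j is j'.+1 then (j'.+1 * schur_bound j').+1 else 2.

Lemma schur_aux (k : nat) (chi : nat -> 'I_k) (m j : nat) (C : {set 'I_k})
    (s : seq nat) :
  #|C| = j -> sorted ltn s -> all (fun x => x <= m) s ->
  {in s &, forall x y, x < y -> chi (y - x) \in C} ->
  schur_bound j <= size s ->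
  exists a b, [/\ 0 < a, 0 < b, a + b <= m, chi a = chi b
                & chi b = chi (a + b)].
Proof.
elim: j C s => [|j IHj] C [|x s] //= cardC.
- case: s => [|y s] //= /andP[ltxy _] _ inC _.
  have := inC x y; rewrite !inE !eqxx ?orbT => /(_ isT isT ltxy).
  by move/eqP: cardC; rewrite cards_eq0 => /eqP ->; rewrite inE.
move=> srt /andP[_ les] inC; rewrite ltnS => szs.
have gtx y : y \in s -> x < y.
  by move=> ys; have /allP := order_path_min ltn_trans srt; apply.
have inCx y : y \in s -> chi (y - x) \in C.
  by move=> ys; apply: inC (gtx y ys); rewrite inE ?eqxx ?ys ?orbT.
pose f col := [seq y <- s | chi (y - x) == col].
have szf : \sum_(col in C) size (f col) = size s.
  under eq_bigr => col _ do rewrite size_filter -sum1_count big_mkcond.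
  rewrite exchange_big /= -sum1_size big_seq [RHS]big_seq.
  apply: eq_bigr => y ys; rewrite (bigD1 (chi (y - x))) ?inCx //= eqxx.
  by rewrite big1 // => col /andP[_]; rewrite eq_sym => /negbTE ->.
have [col colC szcol] : exists2 col, col \in C & schur_bound j <= size (f col).
  apply/exists_inP; apply: contraLR szs => /exists_inPn small.
  rewrite -ltnNge -szf -cardC -sum_nat_const.
  have /card_gt0P[c0 c0C] : 0 < #|C| by rewrite cardC.
  rewrite (bigD1 c0) //= [X in _ < X](bigD1 c0) //= -addSn leq_add //.
    by rewrite ltnNge small.
  by apply: leq_sum => c /andP[cC _]; apply: ltnW; rewrite ltnNge small.
have fP y : y \in f col -> chi (y - x) = col /\ y \in s.
  by rewrite mem_filter => /andP[/eqP].
have [/hasP[y yf /hasP[z zf /andP[ltyz /eqP cyz]]]|no] :=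
  boolP (has (fun y => has (fun z => (y < z) && (chi (z - y) == col)) (f col))
             (f col)).
  have [cy ys] := fP _ yf; have [cz zs] := fP _ zf.
  have xy := gtx y ys; have zm := allP les z zs.
  exists (y - x), (z - y); split; [lia | lia | lia | by rewrite cy cyz |].
  by rewrite cyz -cz; congr (chi _); lia.
apply: (IHj (C :\ col) (f col)) => //.
- by apply/eqP; rewrite -eqSS -cardC (cardsD1 col C) colC.
- by apply: sorted_filter (path_sorted srt); apply: ltn_trans.
- by apply/allP => y /fP[_ ys]; apply: (allP les).
- move=> y z yf zf ltyz; rewrite !inE.
  apply/andP; split.
    apply: contra no => cyz; apply/hasP; exists y => //.
    by apply/hasP; exists z => //; rewrite ltyz.
  have [_ ys] := fP _ yf; have [_ zs] := fP _ zf.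
  by apply: inC ltyz; rewrite inE ?ys ?zs orbT.
Qed.

Lemma unavoidable_schur_exists (k : nat) :
  exists m, unavoidable schur_triple k m.
Proof.
pose m := schur_bound k; exists m; apply/forallP => chi.
have [|||||a [b [a0 b0 abm cab cbc]]] :=
  @schur_aux k (fun i => chi (inord i)) m k [set: 'I_k] (iota 0 m).
- by rewrite cardsT card_ord.
- exact: iota_ltn_sorted.
- by apply/allP => i; rewrite mem_iota => /andP[_ /ltnW].
- by move=> *; rewrite inE.
- by rewrite size_iota.
have [am bm] : a <= m /\ b <= m by lia.
apply/exists_inP; exists (inord a); first by rewrite inE inordK.
apply/exists_inP; exists (inord b); first by rewrite inE inordK.
apply/exists_inP; exists (inord (a + b)).
  by rewrite inE inordK // addn_gt0 a0.
by rewrite /schur_triple !inordK // eqxx cab cbc !eqxx.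
Qed.

Lemma unavoidable_double_sum_exists (k : nat) :
  exists m, unavoidable double_sum_triple k m.
Proof.
have [m /forallP um] := unavoidable_schur_exists k.
exists m; apply/forallP => chi.
have /exists_inP[a aA /exists_inP[b bA /exists_inP[c cA /and3P[abc ab bc]]]] :=
  um chi.
apply/exists_inP; exists a => //; apply/exists_inP; exists b => //.
apply/exists_inP; exists c => //; rewrite /double_sum_triple ab bc !andbT.
by rewrite -[a + b == c]/(schur_triple a b c) abc.
Qed.

Definition schur_number (k : nat) : nat := ex_minn (unavoidable_schur_exists k).

Definition double_sum_schur_number (k : nat) : nat :=
  ex_minn (unavoidable_double_sum_exists k).

(** [g_*(k, n)]; the maximum is over a nonempty family, since it contains the
    empty set when [0 < k]. *)
Definition gstar (k n : nat) : nat :=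
  \max_(A : {set 'I_n.+1} | (A \subset nat_interval 2 n) &&
      [exists chi : {ffun 'I_n.+1 -> 'I_k},
         ~~ has_mono product_schur_triple A chi]) #|A|.

(* Main.v *)
(** Lower bound: colour the integers above [x = n^(1/S')] by putting [a] in
    [(x^j, x^(j+1)]] in the class of [j] for an extremal double-sum colouring
    of the exponents; the index of a product is [i + j] or [i + j + 1].

    Upper bound: put [x = n^(1/S)]. For [a <= x] the powers [a, .., a^S] all lie
    in [[1, n]], and they cannot all lie in [A], since the exponents would
    inherit a Schur-free colouring of [[S]]. For bases in [(x^(1-1/S), x]] these
    sets of powers are pairwise disjoint, so each base accounts for its own
    missing element. *)
Require Import Defs.
From mathcomp Require Import all_boot all_order all_algebra.
From mathcomp Require Import all_classical all_reals all_analysis.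
From mathcomp Require Import zify.

Set Implicit Arguments.
Unset Strict Implicit.
Unset Printing Implicit Defensive.

Import Order.TTheory GRing.Theory Num.Theory.
Local Open Scope ring_scope.

(** * Integer roots and elementary facts on colourings *)

(** Integer roots let both bounds be proved in [nat], real powers entering only in the final
    theorem. The maximum exists because [t <= t ^ s]. *)
Lemma floor_root_exists (s n : nat) :
  (0 < s)%N -> exists t, (t ^ s <= n < t.+1 ^ s)%N.
Proof.
move=> s0; have ex0 : exists t, (t ^ s <= n)%N by exists 0; rewrite exp0n.
have bnd t : (t ^ s <= n)%N -> (t <= n)%N.
  case: t => // t; apply: leq_trans.
  by rewrite -{1}(expn1 t.+1) leq_pexp2l.
case: (ex_maxnP ex0 bnd) => t tn tmax; exists t; rewrite tn ltnNge /=.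
by apply/negP => /tmax; rewrite ltnn.
Qed.

Lemma has_monoP (P : nat -> nat -> nat -> bool) (k m : nat)
    (A : {set 'I_m.+1}) (chi : {ffun 'I_m.+1 -> 'I_k}) :
  reflect (exists a b c, [/\ a \in A, b \in A, c \in A, P a b c
             & chi a = chi b /\ chi b = chi c]) (has_mono P A chi).
Proof.
apply: (iffP exists_inP) => [[a aA /exists_inP[b bA /exists_inP[c cA]]]|].
  by case/and3P=> Pabc /eqP ab /eqP bc; exists a, b, c.
move=> [a [b [c [aA bA cA Pabc [ab bc]]]]].
exists a => //; apply/exists_inP; exists b => //; apply/exists_inP; exists c => //.
by rewrite Pabc ab bc !eqxx.
Qed.

Lemma unavoidable_gt0 (P : nat -> nat -> nat -> bool) (k m : nat) :
  (0 < k)%N -> unavoidable P k m -> (0 < m)%N.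
Proof.
case: k => // k _; case: m => // /forallP /(_ [ffun => ord0]) /has_monoP.
by case=> -[i i1] [b [c [+ _ _ _ _]]]; rewrite inE /=; case: i i1.
Qed.

Lemma schur_number_gt0 (k : nat) : (0 < k)%N -> (0 < schur_number k)%N.
Proof.
by move=> k0; rewrite /schur_number; case: ex_minnP => m /(unavoidable_gt0 k0).
Qed.

Lemma double_sum_schur_number_gt0 (k : nat) :
  (0 < k)%N -> (0 < double_sum_schur_number k)%N.
Proof.
move=> k0; rewrite /double_sum_schur_number.
by case: ex_minnP => m /(unavoidable_gt0 k0).
Qed.

Lemma card_nat_interval (l m : nat) : #|nat_interval l m| = (m.+1 - l)%N.
Proof.
rewrite cardsE -sum1_card; under eq_bigl do rewrite unfold_in /=.
rewrite -(big_mkord (fun i => l <= i)%N (fun=> 1%N)) sum1_count.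
rewrite /index_iota subn0.
have [ml|lm] := leqP m.+1 l.
  rewrite (eqP ml); apply/eqP; rewrite -leqn0 leqNgt -has_count.
  apply/hasPn => i; rewrite mem_iota; lia.
rewrite -{1}(subnKC (ltnW lm)) iotaD count_cat add0n.
rewrite (_ : count _ (iota 0 l) = 0%N); last first.
  apply/eqP; rewrite -leqn0 leqNgt -has_count; apply/hasPn => i.
  by rewrite mem_iota; lia.
rewrite add0n -[RHS](size_iota l); apply/eqP; rewrite -all_count.
by apply/allP => i; rewrite mem_iota => /andP[].
Qed.

(** * Lower bound over the integers *)

Lemma gstar_ge (k n t : nat) : (0 < k)%N -> (0 < n)%N ->
  (n < t.+1 ^ double_sum_schur_number k)%N -> (n - t <= gstar k n)%N.
Proof.
move=> k0 n0 nt.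
have S0 := double_sum_schur_number_gt0 k0.
have t0 : (0 < t)%N by move: nt; rewrite ltnNge; case: t; rewrite // exp1n n0.
(* Logarithms to base [n] require [1 < n]. *)
have [n1|n_gt1] := leqP n 1; first by rewrite (_ : n - t = 0)%N //; lia.
(* Minimality of the double-sum Schur number yields a good colouring of the integers below it. *)
have [chi avoid] : exists chi : {ffun 'I_(double_sum_schur_number k).-1.+1 -> 'I_k},
    ~~ has_mono double_sum_triple (nat_interval 1 _) chi.
  apply/existsP; rewrite -negb_forall; apply/negP => un.
  move: S0 un; rewrite /double_sum_schur_number; case: ex_minnP => m _ minm m0.
  by move=> /minm; lia.
set S := double_sum_schur_number k in S0 nt chi avoid *.
(* This is the [j] with [a] in $(x^j, x^{j+1}]$, where $x = n^{1/S}$; raising to the power [S]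
   avoids the root. *)
pose idx (a : nat) := (up_log n (a ^ S)).-1.
have idxP (a : 'I_n.+1) : (t < a)%N ->
    [/\ (0 < idx a)%N, (idx a < S)%N & (n ^ idx a < a ^ S <= n ^ (idx a).+1)%N].
  move=> ta.
  have na : (n < a ^ S)%N by apply: (leq_trans nt); rewrite leq_exp2r.
  have aS1 : (1 < a ^ S)%N by apply: ltn_trans na.
  have /andP[lo hi] := up_log_bounds n_gt1 aS1.
  have up1 : (1 < up_log n (a ^ S))%N.
    by rewrite ltnNge; apply/negP => le1; have := leq_trans hi (leq_pexp2l n0 le1); lia.
  have upS : (up_log n (a ^ S) <= S)%N.
    by apply: up_log_min => //; rewrite leq_exp2r // -ltnS.
  rewrite /idx; split; [lia | lia |].
  by rewrite lo /= prednK //; lia.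
pose A := nat_interval t.+1 n.
pose psi := [ffun a : 'I_n.+1 => chi (inord (idx a))].
suff noA : ~~ has_mono product_schur_triple A psi.
  rewrite (_ : n - t = #|A|)%N; last by rewrite card_nat_interval subSS.
  rewrite /gstar; apply: (@leq_bigmax_cond _ _ (fun A : {set 'I_n.+1} => #|A|)).
  apply/andP; split; last by apply/existsP; exists psi.
  by apply/fintype.subsetP => a; rewrite !inE; lia.
apply: contra avoid => /has_monoP[a [b [c [+ + + /eqP abc]]]].
rewrite !inE !ffunE => /idxP[a0 aS /andP[alo ahi]] /idxP[b0 bS /andP[blo bhi]].
move=> /idxP[c0 cS /andP[clo chi_]] col.
(* Multiplying the bounds for [a] and [b] and comparing with those for [c] leaves only
   [idx a + idx b] and its successor as values of [idx c]. *)
have lt1 : (idx a + idx b < (idx c).+1)%N.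
  rewrite -(ltn_exp2l _ _ n_gt1); apply: leq_trans chi_.
  by rewrite -abc expnMn expnD ltn_mul.
have lt2 : (idx c < (idx a).+1 + (idx b).+1)%N.
  rewrite -(ltn_exp2l _ _ n_gt1); apply: (leq_trans clo).
  by rewrite -abc expnMn expnD leq_mul.
have small i : (i < S)%N -> (i < S.-1.+1)%N by rewrite prednK.
apply/has_monoP; exists (inord (idx a)), (inord (idx b)), (inord (idx c)).
split => //; rewrite ?inE ?inordK ?small //.
rewrite /double_sum_triple; lia.
Qed.

(** * Upper bound over the integers *)

Lemma missing_power (k n a : nat) (A : {set 'I_n.+1})
    (chi : {ffun 'I_n.+1 -> 'I_k}) :
  (0 < a)%N -> (a ^ schur_number k <= n)%N ->
  ~~ has_mono product_schur_triple A chi ->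
  exists j : 'I_(schur_number k).+1,
    (0 < j)%N && (inord (a ^ j) \notin A).
Proof.
move=> a0 aSn avoid; apply/existsP; apply: contraR avoid => /existsPn allA.
set S := schur_number k in aSn allA *.
have inA (j : 'I_S.+1) : (0 < j)%N -> inord (a ^ j) \in A.
  by move=> j0; have := allA j; rewrite j0 /= negbK.
(* [inord] is faithful here, since [a ^ j <= a ^ S <= n]. *)
have val_pow (j : 'I_S.+1) : (inord (a ^ j) : 'I_n.+1) = (a ^ j)%N :> nat.
  by rewrite inordK // ltnS (leq_trans _ aSn) // leq_pexp2l // -ltnS.
have : unavoidable schur_triple k S.
  by rewrite /S /schur_number; case: ex_minnP.
move=> /forallP /(_ [ffun j : 'I_S.+1 => chi (inord (a ^ j))]) /has_monoP.
case=> p [q [r [+ + + /eqP pqr]]]; rewrite !inE !ffunE => p0 q0 r0 col.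
apply/has_monoP; exists (inord (a ^ p)), (inord (a ^ q)), (inord (a ^ r)).
split; rewrite ?inA //.
by rewrite /product_schur_triple !val_pow -expnD pqr.
Qed.

(** By symmetry let [i <= j]; equal exponents give equal bases. If [i < j <= s], then $is \le (j-1)s
    \le j(s-1)$, so $a^i \le n^{i/s} \le n^{j(s-1)/s^2} < b^j$, a contradiction. The code compares
    the powers of exponent $s^2$. *)
Lemma expn_inj_large (s n a b i j : nat) :
  (0 < i <= s)%N -> (0 < j <= s)%N -> (0 < n)%N ->
  (a ^ s <= n)%N -> (b ^ s <= n)%N ->
  (n ^ s.-1 < a ^ (s ^ 2))%N -> (n ^ s.-1 < b ^ (s ^ 2))%N ->
  (a ^ i = b ^ j)%N -> a = b.
Proof.
move=> + + n0.
wlog ij : a b i j / (i <= j)%N.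
  move=> H ibnd jbnd an bn na nb E; have [ij|/ltnW ji] := leqP i j.
    exact: (H a b i j).
  by symmetry; apply: (H b a j i).
move=> /andP[i0 is_] /andP[j0 js] an _ _ nb E.
move: ij; rewrite leq_eqVlt => /orP[/eqP ij|ij].
  by move: E; rewrite -ij => /eqP; rewrite eqn_exp2r // => /eqP.
have hi : (a ^ (i * s ^ 2) <= n ^ (i * s))%N.
  by rewrite (_ : i * s ^ 2 = s * (i * s))%N; [rewrite expnM leq_exp2r //; lia | lia].
have lo : (n ^ (s.-1 * j) < a ^ (i * s ^ 2))%N.
  by rewrite (expnM a) E -expnM (mulnC j) (expnM b) (expnM n) ltn_exp2r.
have : (n ^ (i * s) <= n ^ (s.-1 * j))%N by rewrite leq_pexp2l //; nia.
by move=> ?; lia.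
Qed.

(** The bases are the integers in $(U, T]$, each costing one element of $[2,n]$. The inequality is
    strict because $[2,n]$ has only $n-1$ elements; this later allows [T.+1], which exceeds $x$, in
    place of [T]. *)
Lemma gstar_le (k n T U : nat) : (0 < k)%N -> (0 < n)%N ->
  (T ^ schur_number k <= n)%N ->
  (n ^ (schur_number k).-1 < U.+1 ^ (schur_number k ^ 2))%N ->
  (gstar k n + T < n + U)%N.
Proof.
move=> k0 n0 Tn nU.
have S0 := schur_number_gt0 k0.
(* Hence every base is at least 2, and its powers lie in $[2,n]$. *)
have U0 : (0 < U)%N.
  by move: nU; rewrite ltnNge; case: U; rewrite // exp1n expn_gt0 n0.
suff bound (A : {set 'I_n.+1}) : (A \subset nat_interval 2 n) &&
    [exists chi : {ffun 'I_n.+1 -> 'I_k}, ~~ has_mono product_schur_triple A chi]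
    -> (#|A| <= n.-1 - (T - U))%N /\ (T - U <= n.-1)%N.
  (* The empty set is admissible, so [T - U <= n.-1] holds and the outer subtraction in the bound is
     not truncated. *)
  have [|_ TUn] := bound finset.set0.
    rewrite finset.sub0set; apply/existsP; case: (k) k0 => // k' _.
    exists [ffun => ord0]; apply/has_monoP => -[a [b [c [+ _ _ _ _]]]].
    by rewrite inE.
  have : (gstar k n <= n.-1 - (T - U))%N.
    by apply/bigmax_leqP => A /bound[].
  by lia.
move=> /andP[A2 /existsP[chi avoid]].
set S := schur_number k in Tn nU S0 *.
have base (a : 'I_T.+1) : (U < a)%N ->
    [/\ (1 < a)%N, (a ^ S <= n)%N & (n ^ S.-1 < a ^ (S ^ 2))%N].
  move=> Ua; split; first by lia.
    by apply: leq_trans Tn; rewrite leq_exp2r // -ltnS.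
  by apply: (leq_trans nU); rewrite leq_exp2r // expn_gt0 S0.
pose good (a : nat) (j : 'I_S.+1) := (0 < j)%N && (inord (a ^ j) \notin A).
(* For [U < a], [missing_power] ensures that the default [ord0] is never taken. *)
pose e (a : 'I_T.+1) : 'I_S.+1 := odflt ord0 [pick j | good a j].
have eP (a : 'I_T.+1) : (U < a)%N -> good a (e a).
  move=> /base[a1 aS _]; rewrite /e; case: pickP => //= none.
  have [j gj] := missing_power (ltnW a1) aS avoid.
  by have := none j; rewrite /good gj.
pose f (a : 'I_T.+1) : 'I_n.+1 := inord (a ^ e a).
have fE (a : 'I_T.+1) : (U < a)%N -> f a = (a ^ e a)%N :> nat.
  move=> /base[a1 aS _]; rewrite inordK // ltnS; apply: leq_trans aS.
  by rewrite leq_pexp2l //; [lia | rewrite -ltnS].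
pose B := nat_interval U.+1 T.
have cardB : #|[set f a | a in B]| = (T - U)%N.
  rewrite card_in_imset ?card_nat_interval ?subSS // => a b.
  rewrite !inE => Ua Ub Eab.
  have [_ aS na] := base a Ua; have [_ bS nb] := base b Ub.
  have /andP[ea _] := eP a Ua; have /andP[eb _] := eP b Ub.
  apply: val_inj => /=.
  apply: (@expn_inj_large S n a b (e a) (e b)) => //.
  - by rewrite ea -ltnS ltn_ord.
  - by rewrite eb -ltnS ltn_ord.
  - by rewrite -!fE // Eab.
have subB : [set f a | a in B] \subset nat_interval 2 n :\: A.
  apply/fintype.subsetP => _ /imsetP[a aB ->]; move: aB; rewrite !inE => Ua.
  have /andP[e0 notA] := eP a Ua; have [a1 _ _] := base a Ua.
  by rewrite notA fE //= -(exp1n (e a)) ltn_exp2r.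
have := subset_leq_card subB; rewrite cardB cardsD.
rewrite (finset.setIidPr A2) card_nat_interval.
have := subset_leq_card A2; rewrite card_nat_interval.
by rewrite subSS subn1; move: #|A| (T - U)%N => cA d; lia.
Qed.

(** * Passage to real exponents *)

Lemma powR_invn_exp (R : realType) (x : R) (s : nat) :
  0 <= x -> (0 < s)%N -> (x `^ (1 / s%:R)) ^+ s = x.
Proof.
move=> x0 s0; rewrite -powR_mulrn ?powR_ge0 // -powRrM div1r mulVf ?powRr1 //.
by rewrite pnatr_eq0 -lt0n.
Qed.

Theorem theorem1p1 (R : realType) (eps : R) (k n : nat)
    (heps : 0 < eps) (hk : (0 < k)%N) (hn : (0 < n)%N)
    (hbig : (2 / eps) ^+ (schur_number k ^ 2)%N < n%:R) :
  n%:R - n%:R `^ (1 / (double_sum_schur_number k)%:R) <= (gstar k n)%:R :> R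
  /\ (gstar k n)%:R <= n%:R - (1 - eps) * n%:R `^ (1 / (schur_number k)%:R) :> R.
Proof.
split.
  have S0 := double_sum_schur_number_gt0 hk.
  have [t /andP[tn nt]] := floor_root_exists n S0.
  have glo := gstar_ge hk hn nt.
  rewrite lerBlDr; apply: (@le_trans _ _ ((gstar k n)%:R + t%:R)).
    by rewrite -natrD ler_nat; lia.
  rewrite lerD2l -(ler_pXn2r S0) ?nnegrE ?powR_ge0 ?ler0n //.
  by rewrite powR_invn_exp ?ler0n // -natrX ler_nat.
have S0 := schur_number_gt0 hk.
set S := schur_number k in S0 hbig *; set x := n%:R `^ _.
have x0 : 0 <= x by apply: powR_ge0.
have xS : x ^+ S = n%:R by rewrite powR_invn_exp ?ler0n.
have SS0 : (0 < S ^ 2)%N by rewrite expn_gt0 S0.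
(* [T] is the integer part of $x$, and [U] that of $n^{(S-1)/S^2} = x^{1-1/S}$. *)
have [T /andP[Tn nT]] := floor_root_exists n S0.
have [U /andP[Un nU]] := floor_root_exists (n ^ S.-1) SS0.
have gup : (gstar k n + T.+1 <= n + U)%N.
  by rewrite addnS; apply: gstar_le.
have xT : x <= T.+1%:R.
  by rewrite -(ler_pXn2r S0) ?nnegrE ?ler0n // xS -natrX ler_nat ltnW.
(* Raised to the power $S^2$, the left side is at most $n^{S-1} \cdot n = x^{S^2}$, by the choice of
   [U] and [hbig]. *)
have Ux : U%:R * (2 / eps) <= x.
  rewrite -(ler_pXn2r SS0) ?nnegrE ?mulr_ge0 ?invr_ge0 ?ler0n ?(ltW heps) //.
  rewrite exprMn -[in leRHS]mulnn exprM xS -[X in _ <= _ ^+ X](prednK S0) exprSr.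
  apply: ler_pM; rewrite ?exprn_ge0 ?divr_ge0 ?ler0n ?(ltW heps) ?(ltW hbig) //.
  by rewrite -!natrX ler_nat.
have Ueps : U%:R <= eps * x.
  rewrite mulrC -ler_pdivrMr //; apply: le_trans Ux.
  rewrite mulrA ler_pM2r ?invr_gt0 //.
  by rewrite -natrM ler_nat leq_pmulr.
rewrite lerBrDr mulrBl mul1r addrA lerBlDr.
apply: (@le_trans _ _ ((gstar k n)%:R + T.+1%:R)); first by rewrite lerD2l.
apply: (@le_trans _ _ (n%:R + U%:R)); first by rewrite -!natrD ler_nat.
by rewrite lerD2l.
Qed.
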